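(* Let $\alpha_n(t)$, $n\geq 0$, $t\geq 0$, be the solution of the Schur flow \[ \alpha_n'(t)=(1-|\alpha_n(t)|^2)\,(\alpha_{n+1}(t)-\alpha_{n-1}(t)),\qquad n=0,1,2,\dots,\qquad \alpha_{-1}(t)\equiv -1, \] with initial conditions satisfying $\alpha_n(0)\in(-1,1)$ for every $n\geq 0$. Then exactly one of the following holds: (i) $\alpha_n(t)\to(-1)^n$ as $t\to\infty$ for all $n\geq 0$; (ii) there exist $1\leq N\leq\infty$ and real numbers $1>x_1>x_2>\cdots>x_N>-1$ such that, as $t\to\infty$, $\alpha_{2n}(t)\to 1$ for all $n\geq 0$, $\alpha_{2n-1}(t)\to -x_n$ for all $1\leq n<N$, and $\alpha_{2n-1}(t)\to -x_N$ for all $n\geq N$; (iii) there exist $1\leq N\leq\infty$ and real numbers $1>x_1>x_2>\cdots>x_N>-1$ such that, as $t\to\infty$, $\alpha_{2n+1}(t)\to -1$ for all $n\geq 0$, $\alpha_{2n}(t)\to x_{n+1}$ for all $0\leq n<N$, and $\alpha_{2n}(t)\to x_N$ for all $n\geq N-1$.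
   Context: $\mathbb{D}=\{z\in\mathbb{C}:|z|<1\}$. For initial data $(\alpha_n(0))_{n\geq0}\in\mathbb{D}^\infty$ the Schur flow system above has a unique global solution with $\alpha_n(t)\in\mathbb{D}$; when all $\alpha_n(0)$ are real, all $\alpha_n(t)$ are real. When $N=\infty$, the conditions involving $x_N$ are vacuous. *)

(* Defs.v *)
From Stdlib Require Import Reals.
From Coquelicot Require Import Coquelicot.
Open Scope R_scope.

Definition alpha_prev (a : nat -> R -> R) (n : nat) (t : R) : R :=
  match n with
  | O => -1
  | S k => a k t
  end.

Definition schur_flow_solution (a : nat -> R -> R) : Prop :=
  (forall n t, 0 < t ->
     is_derive (a n) t ((1 - (a n t) ^ 2) * (a (S n) t - alpha_prev a n t))) /\
  (forall n, filterlim (a n) (at_right 0) (locally (a n 0))) /\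
  (forall n t, 0 <= t -> -1 < a n t < 1).

(* N in {1,2,...} U {oo}: None encodes N = oo. *)
Definition ext_lt (n : nat) (N : option nat) : Prop :=
  match N with Some m => (n < m)%nat | None => True end.
Definition ext_le (n : nat) (N : option nat) : Prop :=
  match N with Some m => (n <= m)%nat | None => True end.
Definition ext_ge (n : nat) (N : option nat) : Prop :=
  match N with Some m => (m <= n)%nat | None => False end.

Definition admissible_seq (N : option nat) (x : nat -> R) : Prop :=
  match N with Some m => (1 <= m)%nat | None => True end /\
  (forall i, (1 <= i)%nat -> ext_le i N -> -1 < x i < 1) /\
  (forall i j, (1 <= i)%nat -> (i < j)%nat -> ext_le j N -> x j < x i).

(* x_N, only used when N is finite *)
Definition last_val (N : option nat) (x : nat -> R) : R :=
  match N with Some m => x m | None => 0 end.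

Definition conv (f : R -> R) (l : R) : Prop := is_lim f p_infty l.

Definition case_i (a : nat -> R -> R) : Prop :=
  forall n, conv (a n) ((-1) ^ n).

Definition case_ii (a : nat -> R -> R) : Prop :=
  exists (N : option nat) (x : nat -> R), admissible_seq N x /\
    (forall n, conv (a (2 * n)%nat) 1) /\
    (forall n, (1 <= n)%nat -> ext_lt n N -> conv (a (2 * n - 1)%nat) (- x n)) /\
    (forall n, ext_ge n N -> conv (a (2 * n - 1)%nat) (- last_val N x)).

Definition case_iii (a : nat -> R -> R) : Prop :=
  exists (N : option nat) (x : nat -> R), admissible_seq N x /\
    (forall n, conv (a (2 * n + 1)%nat) (-1)) /\
    (forall n, ext_lt n N -> conv (a (2 * n)%nat) (x (S n))) /\
    (forall n, ext_ge (S n) N -> conv (a (2 * n)%nat) (last_val N x)).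

(* Main.v *)
Require Import Defs.
From Stdlib Require Import Reals Lra Lia Classical.
From Coquelicot Require Import Coquelicot.
Open Scope R_scope.

(** Put [g_n = (-1)^n alpha_{n-1}]. The products [W_n = (1 - g_{n-1}) (1 + g_n)] obey
    the Volterra lattice [W_n' = W_n (W_{n-1} - W_{n+1})] with [W_0 = 0], and pairing
    neighbours, starting either from [W_0] or from [W_1], gives two Toda chains
    [b_k' = A_{k+1} - A_k], [A_{k+1}' = A_{k+1} (b_{k+1} - b_k)] (Geronimus relations).

    In a bounded Toda chain the sums [b_0 + ... + b_{n-1}] are nondecreasing with
    derivative [A_n], so [b_k] converges to some [y_k] and [A_k] to [0]; as
    [(ln A_{k+1})' -> y_{k+1} - y_k], the [y_k] are nonincreasing. Strict descent makes
    [A_{k+1}] exponentially small, equality makes it subexponential. For a finite maximal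
    block of equal limits [y] the trace of [(J - y)^2] over the block has exponentially
    small derivative, hence is itself exponentially small, which is incompatible with
    subexponential couplings inside: once two consecutive limits agree, all later ones
    do. The same comparison shows that [b_k] would increase to [-2] if [y_k = -2],
    contradicting [b_k > -2].

    The first chain has [b_0 = 2 alpha_0]. If its top limit is below [2], solving for
    the [alpha_n] one after the other gives (iii); otherwise [alpha_0 -> 1], and the
    second chain gives (ii) when its top limit is below [2]; if it is [2] as well,
    then all limits of the first chain are [2], which is (i). *)

(** * Limits at infinity and monotone functions of time *)

Definition ultimately (P : R -> Prop) : Prop := Rbar_locally' p_infty P.

Lemma ultimately_imp (P Q : R -> Prop) :
  (forall t, P t -> Q t) -> ultimately P -> ultimately Q.
Proof. exact (@filter_imp _ (Rbar_locally' p_infty) _ P Q). Qed.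

Lemma ultimately_and (P Q : R -> Prop) :
  ultimately P -> ultimately Q -> ultimately (fun t => P t /\ Q t).
Proof. exact (@filter_and _ (Rbar_locally' p_infty) _ P Q). Qed.

Lemma ultimately_gt (T : R) : ultimately (fun t => T < t).
Proof. exists T; auto. Qed.

Lemma lim_ultimately_lt (f : R -> R) (l c : R) :
  is_lim f p_infty l -> l < c -> ultimately (fun t => f t < c).
Proof.
  intros Hf Hc. apply is_lim_spec in Hf.
  assert (He : 0 < c - l) by lra.
  generalize (Hf (mkposreal _ He)). apply ultimately_imp. simpl.
  intros t Ht. apply Rabs_def2 in Ht. lra.
Qed.

Lemma lim_ultimately_gt (f : R -> R) (l c : R) :
  is_lim f p_infty l -> c < l -> ultimately (fun t => c < f t).
Proof.
  intros Hf Hc. apply is_lim_spec in Hf.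
  assert (He : 0 < l - c) by lra.
  generalize (Hf (mkposreal _ He)). apply ultimately_imp. simpl.
  intros t Ht. apply Rabs_def2 in Ht. lra.
Qed.

Lemma lim_mult (f g : R -> R) (lf lg : R) :
  is_lim f p_infty lf -> is_lim g p_infty lg ->
  is_lim (fun t => f t * g t) p_infty (lf * lg).
Proof. intros Hf Hg. exact (is_lim_mult f g p_infty lf lg Hf Hg I). Qed.

Lemma lim_div (f g : R -> R) (lf lg : R) :
  is_lim f p_infty lf -> is_lim g p_infty lg -> lg <> 0 ->
  is_lim (fun t => f t / g t) p_infty (lf / lg).
Proof.
  intros Hf Hg H.
  apply (is_lim_div f g p_infty lf lg Hf Hg); simpl; auto.
  intros E. apply H. now injection E.
Qed.

Lemma lim_ext_pos (f g : R -> R) (l l' : R) :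
  (forall t, 0 < t -> f t = g t) -> l = l' ->
  is_lim f p_infty l -> is_lim g p_infty l'.
Proof.
  intros H <-. apply is_lim_ext_loc. exists 0. exact H.
Qed.

Lemma lim_le (f g : R -> R) (lf lg : R) :
  ultimately (fun t => f t <= g t) ->
  is_lim f p_infty lf -> is_lim g p_infty lg -> lf <= lg.
Proof. intros H Hf Hg. exact (is_lim_le_loc f g p_infty lf lg H Hf Hg). Qed.

Lemma lim_mult_bounded_0 (f g : R -> R) (M : R) :
  (forall t, 0 < t -> Rabs (f t) <= M) ->
  is_lim g p_infty 0 -> is_lim (fun t => f t * g t) p_infty 0.
Proof.
  intros Hf Hg. apply is_lim_spec. intros [e He]. simpl.
  assert (HM : 0 <= M).
  { generalize (Hf 1 Rlt_0_1) (Rabs_pos (f 1)). lra. }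
  (* Dividing by [M + 1] rather than [M] covers [M = 0]. *)
  assert (He' : 0 < e / (M + 1)) by (apply Rdiv_lt_0_compat; lra).
  apply is_lim_spec in Hg.
  generalize (ultimately_and _ _ (ultimately_gt 0) (Hg (mkposreal _ He'))).
  apply ultimately_imp. simpl. intros t [Ht H].
  rewrite Rminus_0_r in *. rewrite Rabs_mult.
  apply Rle_lt_trans with (M * Rabs (g t)).
  - apply Rmult_le_compat_r; [apply Rabs_pos | auto].
  - apply Rle_lt_trans with ((M + 1) * Rabs (g t)).
    + generalize (Rabs_pos (g t)). nra.
    + apply (Rmult_lt_compat_l (M + 1)) in H; [|lra].
      replace ((M + 1) * (e / (M + 1))) with e in H by (field; lra). exact H.
Qed.

(** Mean value theorem on [[s, t]]. The threshold [T] admits signs of the derivative that are known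
    only for large times. *)
Lemma derive_nonneg_nondecreasing (f df : R -> R) (T : R) :
  (forall t, T < t -> is_derive f t (df t)) ->
  (forall t, T < t -> 0 <= df t) ->
  forall s t, T < s -> s <= t -> f s <= f t.
Proof.
  intros Hd Hp s t Hs Hst.
  destruct (MVT_gen f s t df) as [c [Hc E]].
  - intros x Hx. apply Hd. rewrite Rmin_left in Hx by lra. lra.
  - intros x Hx. rewrite Rmin_left in Hx by lra.
    apply derivable_continuous_pt. exists (df x).
    apply is_derive_Reals, Hd. lra.
  - rewrite Rmin_left in Hc by lra.
    assert (0 <= df c) by (apply Hp; lra). nra.
Qed.

Lemma nondecreasing_le_lim (f : R -> R) (T l : R) :
  (forall s t, T < s -> s <= t -> f s <= f t) ->
  is_lim f p_infty l -> forall t, T < t -> f t <= l.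
Proof.
  intros Hm Hl t Ht.
  apply (lim_le (fun _ => f t) f); auto using is_lim_const.
  exists t. intros s Hs. apply Hm; lra.
Qed.

(** The limit is the supremum of the values taken after [T]. *)
Lemma nondecreasing_bounded_lim (f : R -> R) (T M : R) :
  (forall s t, T < s -> s <= t -> f s <= f t) ->
  (forall t, T < t -> f t <= M) ->
  exists l : R, is_lim f p_infty l.
Proof.
  intros Hm Hb.
  destruct (completeness (fun y => exists t, T < t /\ y = f t)) as [l [Hu Hl]].
  - exists M. intros y [t [Ht ->]]. auto.
  - exists (f (T + 1)), (T + 1). split; [lra | easy].
  - exists l. apply is_lim_spec. intros [e He]. simpl.
    destruct (classic (exists t, T < t /\ l - e < f t)) as [[t [Ht H]] | H].
    + exists t. intros s Hs.
      assert (f s <= l) by (apply Hu; exists s; split; [lra | easy]).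
      assert (f t <= f s) by (apply Hm; lra).
      apply Rabs_def1; lra.
    + exfalso. assert (l <= l - e); [|lra].
      apply Hl. intros y [t [Ht ->]].
      apply Rnot_lt_le. intros Hlt. apply H. exists t. auto.
Qed.

(** * Exponential and subexponential decay *)

(** One-sided: it bounds [f] itself from above, not its absolute value, and [C] may have any
    sign. *)
Definition exp_decay (f : R -> R) : Prop :=
  exists c C, 0 < c /\ ultimately (fun t => f t <= C * exp (- c * t)).

Definition subexp_decay (f : R -> R) : Prop :=
  forall c, 0 < c -> exists C, 0 < C /\ ultimately (fun t => C * exp (- c * t) <= f t).

(** Use the lower bound for [g] at half the rate of [f]: [C * exp (- c * t)] is below
    [D * exp (- (c / 2) * t)] as soon as [C < D * (c / 2 * t)], because [exp x > 1 + x] for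
    [x > 0]. *)
Lemma exp_decay_lt_subexp (f g : R -> R) :
  exp_decay f -> subexp_decay g -> ultimately (fun t => f t < g t).
Proof.
  intros [c [C [Hc Hf]]] Hg.
  assert (Hc2 : 0 < c / 2) by lra.
  destruct (Hg _ Hc2) as [D [HD HgD]].
  generalize (ultimately_and _ _ (ultimately_and _ _ (ultimately_gt 0) (ultimately_gt (2 * C / (c * D))))
    (ultimately_and _ _ Hf HgD)).
  apply ultimately_imp. intros t [[Ht0 Ht] [H1 H2]].
  apply Rle_lt_trans with (1 := H1). apply Rlt_le_trans with (2 := H2).
  replace (- c * t) with (- (c / 2) * t + - (c / 2) * t) by field.
  rewrite exp_plus, <- Rmult_assoc.
  apply Rmult_lt_compat_r; [apply exp_pos|].
  assert (E : exp (- (c / 2) * t) * exp (c / 2 * t) = 1).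
  { rewrite <- exp_plus. rewrite <- exp_0. f_equal. ring. }
  assert (H : 1 + c / 2 * t < exp (c / 2 * t)) by (apply exp_ineq1; nra).
  assert (HCt : C < D * (c / 2 * t)).
  { apply (Rmult_lt_compat_l (c * D / 2)) in Ht; [|nra].
    replace (c * D / 2 * (2 * C / (c * D))) with C in Ht by (field; lra). lra. }
  assert (HCe : C < D * exp (c / 2 * t)) by nra.
  assert (0 < exp (- (c / 2) * t)) by apply exp_pos. 
  apply (Rmult_lt_compat_r (exp (- (c / 2) * t))) in HCe; [|easy].
  rewrite Rmult_assoc, (Rmult_comm (exp (c / 2 * t))), E in HCe. lra.
Qed.

Lemma exp_decay_plus (f g : R -> R) :
  exp_decay f -> exp_decay g -> exp_decay (fun t => f t + g t).
Proof.
  intros [c [C [Hc Hf]]] [d [D [Hd Hg]]].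
  (* Passing to the slower rate only enlarges a bound with nonnegative amplitude, hence the absolute
     values. *)
  exists (Rmin c d), (Rabs C + Rabs D). split; [apply Rmin_pos; easy|].
  generalize (ultimately_and _ _ (ultimately_gt 0) (ultimately_and _ _ Hf Hg)).
  apply ultimately_imp. intros t [Ht [H1 H2]].
  assert (Hm : forall e, Rmin c d <= e -> exp (- e * t) <= exp (- Rmin c d * t)).
  { intros e He.
    destruct (Req_dec (Rmin c d) e) as [<- | Hne]; [apply Rle_refl|].
    left. apply exp_increasing. nra. }
  assert (Hc' := Hm _ (Rmin_l c d)). assert (Hd' := Hm _ (Rmin_r c d)).
  assert (0 < exp (- c * t)) by apply exp_pos.
  assert (0 < exp (- d * t)) by apply exp_pos.
  assert (HC := Rle_abs C). assert (HD := Rle_abs D).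
  assert (HC0 := Rabs_pos C). assert (HD0 := Rabs_pos D).
  nra.
Qed.

Lemma exp_decay_scal (f : R -> R) (k : R) :
  0 <= k -> exp_decay f -> exp_decay (fun t => k * f t).
Proof.
  intros Hk [c [C [Hc Hf]]]. exists c, (k * C). split; [easy|].
  revert Hf. apply ultimately_imp. intros t H. rewrite Rmult_assoc.
  now apply Rmult_le_compat_l.
Qed.

(** Here [g] is the logarithmic derivative of [f]. It is eventually below [l / 2], so
    [f t * exp (c * t)] with [c = - (l / 2)] is eventually nonincreasing. *)
Lemma exp_decay_log_derive (f g : R -> R) (l : R) :
  (forall t, 0 < t -> is_derive f t (f t * g t)) ->
  (forall t, 0 < t -> 0 < f t) ->
  is_lim g p_infty l -> l < 0 -> exp_decay f.
Proof.
  intros Hd Hp Hg Hl.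
  destruct (ultimately_and _ _ (ultimately_gt 0)
    (lim_ultimately_lt g l (l / 2) Hg ltac:(lra))) as [T HT].
  set (c := - (l / 2)).
  assert (Hm : forall s t, T < s -> s <= t ->
    - (f s * exp (c * s)) <= - (f t * exp (c * t))).
  { apply derive_nonneg_nondecreasing with
      (df := fun t => - (f t * (g t + c) * exp (c * t))).
    - intros t Ht. destruct (HT t Ht) as [H0 _].
      specialize (Hd t H0). auto_derive.
      + now exists (f t * g t).
      + replace (Derive (fun x => f x) t) with (f t * g t)
          by (symmetry; now apply is_derive_unique). ring.
    - intros t Ht. destruct (HT t Ht) as [H0 H1]. specialize (Hp t H0).
      assert (0 < exp (c * t)) by apply exp_pos.
      assert (g t + c < 0) by (unfold c; lra).
      assert (f t * (g t + c) <= 0) by nra. nra. }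
  exists c, (f (T + 1) * exp (c * (T + 1))). split; [unfold c; lra|].
  exists (T + 1). intros t Ht.
  specialize (Hm (T + 1) t ltac:(lra) ltac:(lra)).
  assert (E : exp (- c * t) * exp (c * t) = 1).
  { rewrite <- exp_plus, <- exp_0. f_equal. ring. }
  assert (0 < exp (- c * t)) by apply exp_pos.
  replace (f t) with (f t * exp (c * t) * exp (- c * t))
    by (rewrite Rmult_assoc, (Rmult_comm (exp (c * t))), E; ring).
  apply Rmult_le_compat_r; lra.
Qed.

(** For each [c > 0] the logarithmic derivative [g] eventually exceeds [- c], so [f t * exp (c * t)]
    is eventually nondecreasing and stays above a positive value. *)
Lemma subexp_decay_log_derive (f g : R -> R) :
  (forall t, 0 < t -> is_derive f t (f t * g t)) ->
  (forall t, 0 < t -> 0 < f t) ->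
  is_lim g p_infty 0 -> subexp_decay f.
Proof.
  intros Hd Hp Hg c Hc.
  destruct (ultimately_and _ _ (ultimately_gt 0)
    (lim_ultimately_gt g 0 (- c) Hg ltac:(lra))) as [T HT].
  assert (Hm : forall s t, T < s -> s <= t ->
    f s * exp (c * s) <= f t * exp (c * t)).
  { apply derive_nonneg_nondecreasing with
      (df := fun t => f t * (g t + c) * exp (c * t)).
    - intros t Ht. destruct (HT t Ht) as [H0 _].
      specialize (Hd t H0). auto_derive.
      + now exists (f t * g t).
      + replace (Derive (fun x => f x) t) with (f t * g t)
          by (symmetry; now apply is_derive_unique). ring.
    - intros t Ht. destruct (HT t Ht) as [H0 H1]. specialize (Hp t H0).
      assert (0 < exp (c * t)) by apply exp_pos.
      assert (0 < g t + c) by lra.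
      assert (0 <= f t * (g t + c)) by nra. nra. }
  exists (f (T + 1) * exp (c * (T + 1))). split.
  { apply Rmult_lt_0_compat; [|apply exp_pos].
    apply Hp. now destruct (HT (T + 1) ltac:(lra)). }
  exists (T + 1). intros t Ht.
  specialize (Hm (T + 1) t ltac:(lra) ltac:(lra)).
  assert (E : exp (- c * t) * exp (c * t) = 1).
  { rewrite <- exp_plus, <- exp_0. f_equal. ring. }
  assert (0 < exp (- c * t)) by apply exp_pos.
  replace (f t) with (f t * exp (c * t) * exp (- c * t))
    by (rewrite Rmult_assoc, (Rmult_comm (exp (c * t))), E; ring).
  apply Rmult_le_compat_r; lra.
Qed.

(** This replaces integrating [- df] from [t] to infinity: [f t - C / c * exp (- c * t)] is
    eventually nondecreasing and tends to [0], hence is at most [0]. *)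
Lemma exp_decay_of_derive (f df : R -> R) :
  (forall t, 0 < t -> is_derive f t (df t)) ->
  exp_decay (fun t => - df t) ->
  is_lim f p_infty 0 -> exp_decay f.
Proof.
  intros Hd [c [C [Hc H]]] Hl.
  destruct (ultimately_and _ _ (ultimately_gt 0) H) as [T HT].
  exists c, (C / c). split; [easy|].
  assert (He : is_lim (fun t => C / c * exp (- c * t)) p_infty 0).
  { replace (Finite 0) with (Rbar_mult (C / c) 0) by (simpl; f_equal; ring).
    apply is_lim_scal_l.
    apply is_lim_comp with (k := 0) (l := m_infty) (f := exp).
    - apply is_lim_exp_m.
    - replace m_infty with (Rbar_mult (- c) p_infty).
      + apply is_lim_scal_l, is_lim_id.
      + rewrite Rbar_mult_comm. apply is_Rbar_mult_unique.
        apply is_Rbar_mult_p_infty_neg. simpl; lra.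
    - exists 0. easy. }
  exists T. intros t Ht.
  enough (f t - C / c * exp (- c * t) <= 0) by lra.
  apply (nondecreasing_le_lim (fun t => f t - C / c * exp (- c * t)) T).
  - apply derive_nonneg_nondecreasing with
      (df := fun t => df t + C * exp (- c * t)).
    + intros s Hs. destruct (HT s Hs) as [H0 _]. specialize (Hd s H0).
      auto_derive.
      * now exists (df s).
      * replace (Derive (fun x => f x) s) with (df s)
          by (symmetry; now apply is_derive_unique). field. lra.
    + intros s Hs. destruct (HT s Hs) as [_ H1]. lra.
  - replace 0 with (0 - 0) by ring. now apply is_lim_minus'.
  - exact Ht.
Qed.

Lemma is_derive_eq (f : R -> R) (x l l' : R) :
  is_derive f x l -> l = l' -> is_derive f x l'.
Proof. intros H <-. exact H. Qed.

(** * The Toda chain *)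

(** [b n] is a diagonal entry of a half-infinite Jacobi matrix and [A (S n)] the squared entry
    coupling sites [n] and [S n]; [A O = 0] is the free left end. The strict bound [-2 < b n t] is
    what later excludes the limit [-2]. *)
Record toda_chain (b A : nat -> R -> R) : Prop := {
  toda_db : forall n t, 0 < t -> is_derive (b n) t (A (S n) t - A n t);
  toda_dA : forall n t, 0 < t ->
    is_derive (A (S n)) t (A (S n) t * (b (S n) t - b n t));
  toda_A0 : forall t, A O t = 0;
  toda_A_pos : forall n t, 0 < t -> 0 < A (S n) t;
  toda_A_bounded : forall n, exists M, forall t, 0 < t -> A n t <= M;
  toda_b_bounded : forall n t, 0 < t -> -2 < b n t <= 2 }.

Lemma toda_A_nonneg (b A : nat -> R -> R) :
  toda_chain b A -> forall n t, 0 < t -> 0 <= A n t.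
Proof.
  intros H [|n] t Ht.
  - rewrite (toda_A0 _ _ H). apply Rle_refl.
  - left. now apply (toda_A_pos _ _ H).
Qed.

Fixpoint psum (b : nat -> R -> R) (n : nat) (t : R) : R :=
  match n with O => 0 | S k => psum b k t + b k t end.

Lemma is_derive_psum_toda (b A : nat -> R -> R) (n : nat) (t : R) :
  toda_chain b A -> 0 < t -> is_derive (psum b n) t (A n t).
Proof.
  intros H Ht. induction n as [|n IH].
  - rewrite (toda_A0 _ _ H). exact (is_derive_const 0 t).
  - apply is_derive_eq with (A n t + (A (S n) t - A n t)); [|ring].
    apply (is_derive_plus (psum b n) (b n)); auto.
    now apply (toda_db _ _ H).
Qed.

Lemma psum_le (b : nat -> R -> R) (n : nat) (t : R) :
  (forall k, b k t <= 2) -> psum b n t <= 2 * INR n.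
Proof.
  intros H. induction n as [|n IH]; [simpl; lra|].
  rewrite S_INR. simpl. specialize (H n). lra.
Qed.

Lemma toda_psum_lim (b A : nat -> R -> R) :
  toda_chain b A -> forall n, exists l : R, is_lim (psum b n) p_infty l.
Proof.
  intros H n. apply nondecreasing_bounded_lim with (T := 0) (M := 2 * INR n).
  - apply derive_nonneg_nondecreasing with (df := A n).
    + intros t Ht. now apply is_derive_psum_toda.
    + intros t Ht. now apply (toda_A_nonneg _ _ H).
  - intros t Ht. apply psum_le. intros k. now apply (toda_b_bounded _ _ H).
Qed.

Lemma toda_b_lim (b A : nat -> R -> R) :
  toda_chain b A -> forall n, exists l : R, is_lim (b n) p_infty l.
Proof.
  intros H n.
  destruct (toda_psum_lim _ _ H n) as [l1 H1].
  destruct (toda_psum_lim _ _ H (S n)) as [l2 H2].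
  exists (l2 - l1).
  apply lim_ext_pos with (3 := is_lim_minus' _ _ _ _ _ H2 H1); [|easy].
  intros t _. simpl. ring.
Qed.

(* [A_n + 4 (b_0 + ... + b_{n-1})] is nondecreasing, hence [A_n] converges; its
   limit vanishes because [A_n] is the derivative of a bounded function. *)
Lemma toda_A_lim (b A : nat -> R -> R) :
  toda_chain b A -> forall n, is_lim (A n) p_infty 0.
Proof.
  intros H [|n].
  { apply lim_ext_pos with (f := fun _ => 0) (l := 0); auto using is_lim_const.
    intros t _. now rewrite (toda_A0 _ _ H). }
  destruct (toda_psum_lim _ _ H (S n)) as [s Hs].
  destruct (toda_A_bounded _ _ H (S n)) as [M HM].
  (* The factor [4] dominates [b n t - b (S n) t], both terms lying between [-2] and [2]. *)
  destruct (nondecreasing_bounded_lim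
    (fun t => A (S n) t + 4 * psum b (S n) t) 0 (M + 4 * (2 * INR (S n)))) as [l Hl].
  - apply derive_nonneg_nondecreasing with
      (df := fun t => A (S n) t * (b (S n) t - b n t) + 4 * A (S n) t).
    + intros t Ht. apply (is_derive_plus (A (S n)) (fun t => 4 * psum b (S n) t)).
      * now apply (toda_dA _ _ H).
      * apply is_derive_scal. now apply is_derive_psum_toda.
    + intros t Ht.
      assert (Hp := toda_A_pos _ _ H n t Ht).
      assert (H1 := toda_b_bounded _ _ H n t Ht).
      assert (H2 := toda_b_bounded _ _ H (S n) t Ht). nra.
  - intros t Ht. specialize (HM t Ht).
    assert (psum b (S n) t <= 2 * INR (S n)); [|lra].
    apply psum_le. intros k. now apply (toda_b_bounded _ _ H).
  - assert (HA : is_lim (A (S n)) p_infty (l - 4 * s)).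
    { apply lim_ext_pos with (3 := is_lim_minus' _ _ _ _ _ Hl
        (lim_mult _ _ _ _ (is_lim_const 4 p_infty) Hs)); [|easy].
      intros t _. ring. }
    replace 0 with (l - 4 * s); [exact HA|].
    set (L := l - 4 * s) in *.
    assert (HL : 0 <= L).
    { apply (lim_le (fun _ => 0) (A (S n))); auto using is_lim_const.
      exists 0. intros t Ht. now apply (toda_A_nonneg _ _ H). }
    destruct HL as [HL | HL]; [exfalso | easy].
    destruct (ultimately_and _ _ (ultimately_gt 0)
      (lim_ultimately_gt _ _ (L / 2) HA ltac:(lra))) as [T HT].
    assert (Hm : forall u t, T < u -> u <= t ->
      psum b (S n) u - L / 2 * u <= psum b (S n) t - L / 2 * t).
    { apply derive_nonneg_nondecreasing with (df := fun t => A (S n) t - L / 2).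
      - intros t Ht. destruct (HT t Ht) as [H0 _].
        apply is_derive_eq with (A (S n) t - L / 2 * 1); [|ring].
        apply (is_derive_minus (psum b (S n)) (fun t => L / 2 * t)).
        + now apply is_derive_psum_toda.
        + apply is_derive_scal. apply (is_derive_id t).
      - intros t Ht. destruct (HT t Ht). lra. }
    set (N := 2 * INR (S n)).
    set (u := T + 1).
    (* Growth at rate [L / 2] from time [u] on carries the sum to at least [N + 1] at this time,
       past its bound [N]. *)
    set (t := u + (N - psum b (S n) u + 1) / (L / 2)).
    assert (HB : forall v, 0 < v -> psum b (S n) v <= N).
    { intros v Hv. apply psum_le. intros k. now apply (toda_b_bounded _ _ H). }
    destruct (HT u ltac:(unfold u; lra)) as [Hu _].
    assert (HBu := HB u Hu).
    assert (Hd : 0 < (N - psum b (S n) u + 1) / (L / 2))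
      by (apply Rdiv_lt_0_compat; lra).
    assert (HBt : psum b (S n) t <= N) by (apply HB; unfold t; lra).
    specialize (Hm u t ltac:(unfold u; lra) ltac:(unfold t; lra)).
    assert (E : L / 2 * (t - u) = N - psum b (S n) u + 1)
      by (unfold t; field; lra).
    lra.
Qed.

(** * Order and repetition among the limits of a Toda chain *)

(** If [y n < y (S n)], the positive [A (S n)] is eventually nondecreasing and cannot tend to
    [0]. *)
Lemma toda_lim_nonincreasing (b A : nat -> R -> R) (y : nat -> R) :
  toda_chain b A -> (forall n, is_lim (b n) p_infty (y n)) ->
  forall n, y (S n) <= y n.
Proof.
  intros H Hy n. apply Rnot_lt_le. intros Hlt.
  destruct (ultimately_and _ _ (ultimately_gt 0)
    (lim_ultimately_gt _ _ 0 (is_lim_minus' _ _ _ _ _ (Hy (S n)) (Hy n)) ltac:(lra)))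
    as [T HT].
  assert (Hm : forall s t, T < s -> s <= t -> A (S n) s <= A (S n) t).
  { apply derive_nonneg_nondecreasing with
      (df := fun t => A (S n) t * (b (S n) t - b n t)).
    - intros t Ht. apply (toda_dA _ _ H). now destruct (HT t Ht).
    - intros t Ht. destruct (HT t Ht) as [H0 H1].
      assert (Hp := toda_A_pos _ _ H n t H0). nra. }
  assert (Hle := nondecreasing_le_lim _ _ _ Hm (toda_A_lim _ _ H (S n))
    (T + 1) ltac:(lra)).
  destruct (HT (T + 1) ltac:(lra)) as [H0 _].
  assert (Hp := toda_A_pos _ _ H n _ H0). lra.
Qed.

Lemma toda_A_exp_decay (b A : nat -> R -> R) (y : nat -> R) :
  toda_chain b A -> (forall n, is_lim (b n) p_infty (y n)) ->
  forall n, y (S n) < y n -> exp_decay (A (S n)).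
Proof.
  intros H Hy n Hlt.
  apply exp_decay_log_derive with
    (g := fun t => b (S n) t - b n t) (l := y (S n) - y n).
  - intros t Ht. now apply (toda_dA _ _ H).
  - intros t Ht. now apply (toda_A_pos _ _ H).
  - now apply is_lim_minus'.
  - lra.
Qed.

Lemma toda_A_subexp_decay (b A : nat -> R -> R) (y : nat -> R) :
  toda_chain b A -> (forall n, is_lim (b n) p_infty (y n)) ->
  forall n, y (S n) = y n -> subexp_decay (A (S n)).
Proof.
  intros H Hy n E.
  apply subexp_decay_log_derive with (g := fun t => b (S n) t - b n t).
  - intros t Ht. now apply (toda_dA _ _ H).
  - intros t Ht. now apply (toda_A_pos _ _ H).
  - replace 0 with (y (S n) - y n) by (rewrite E; ring). now apply is_lim_minus'.
Qed.

(** Go left from [n] while the limit stays the same. The walk stops at site [0], where [A O = 0], or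
    at a strict drop, where the coupling decays exponentially. *)
Lemma toda_block_start (b A : nat -> R -> R) (y : nat -> R) :
  toda_chain b A -> (forall n, is_lim (b n) p_infty (y n)) ->
  forall n, exists k, (k <= n)%nat /\ y k = y n /\ exp_decay (A k) /\
    (forall i, (k <= i <= n)%nat -> y i = y n).
Proof.
  intros H Hy. induction n as [|n IH].
  - exists O. split; [lia|]. split; [easy|]. split.
    + exists 1, 0. split; [lra|]. exists 0. intros t _.
      rewrite (toda_A0 _ _ H). lra.
    + intros i Hi. now replace i with O by lia.
  - destruct (toda_lim_nonincreasing _ _ _ H Hy n) as [Hlt | E].
    + exists (S n). split; [lia|]. split; [easy|]. split.
      * now apply toda_A_exp_decay with (b := b) (y := y).
      * intros i Hi. now replace i with (S n) by lia.
    + destruct IH as [k [Hk [Ek [HA Hi]]]].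
      exists k. split; [lia|]. split; [congruence|]. split; [easy|].
      intros i Hki. destruct (Nat.eq_dec i (S n)) as [->|Hne]; [easy|].
      rewrite E. apply Hi. lia.
Qed.

(* The trace of [(J_n - y)^2], where [J_n] is the leading n x n block of the Lax
   matrix with diagonal [b_i] and squared off-diagonal entries [A_i]. *)
Fixpoint block_energy (b A : nat -> R -> R) (y : R) (n : nat) (t : R) : R :=
  match n with
  | O => 0
  | S k => block_energy b A y k t + ((b k t - y) ^ 2 + 2 * A k t)
  end.

(** The contributions of the inner couplings telescope, and only the flux through the right end of
    the block remains. *)
Lemma is_derive_block_energy (b A : nat -> R -> R) (y : R) (n : nat) (t : R) :
  toda_chain b A -> 0 < t ->
  is_derive (block_energy b A y n) t
    (match n with O => 0 | S k => 2 * A (S k) t * (b k t - y) end).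
Proof.
  intros H Ht. induction n as [|n IH]; [exact (is_derive_const 0 t)|].
  assert (Hb := toda_db _ _ H n t Ht).
  assert (Hsq : is_derive (fun t => (b n t - y) ^ 2) t
    (2 * (b n t - y) * (A (S n) t - A n t))).
  { auto_derive.
    - now exists (A (S n) t - A n t).
    - replace (Derive (fun x => b n x) t) with (A (S n) t - A n t)
        by (symmetry; now apply is_derive_unique). ring. }
  assert (HA : is_derive (A n) t
    (match n with O => 0 | S k => A n t * (b n t - b k t) end)).
  { destruct n as [|k]; [|now apply (toda_dA _ _ H)].
    apply is_derive_ext with (fun _ => 0); [|exact (is_derive_const 0 t)].
    intros s. now rewrite (toda_A0 _ _ H). }
  eapply is_derive_eq.
  - apply (is_derive_plus (block_energy b A y n)
      (fun t => (b n t - y) ^ 2 + 2 * A n t)); [exact IH|].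
    apply (is_derive_plus (fun t => (b n t - y) ^ 2) (fun t => 2 * A n t));
      [exact Hsq|]. apply is_derive_scal. exact HA.
  - unfold plus; simpl. destruct n as [|k].
    + rewrite (toda_A0 _ _ H). ring.
    + ring.
Qed.

(** The constant is [2 * 4], since [b k t] and [y] are at most [4] apart. *)
Lemma block_energy_derive_bound (b A : nat -> R -> R) (y : R) (n : nat) (t : R) :
  toda_chain b A -> 0 < t -> -2 <= y <= 2 ->
  Rabs (match n with O => 0 | S k => 2 * A (S k) t * (b k t - y) end) <= 8 * A n t.
Proof.
  intros H Ht Hy. destruct n as [|k].
  - rewrite Rabs_R0, (toda_A0 _ _ H). lra.
  - assert (Hp := toda_A_pos _ _ H k t Ht).
    assert (Hb := toda_b_bounded _ _ H k t Ht).
    apply Rabs_le. nra.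
Qed.

Lemma toda_lim_stationary (b A : nat -> R -> R) (y : nat -> R) :
  toda_chain b A -> (forall n, is_lim (b n) p_infty (y n)) ->
  forall n, y (S n) = y n -> y (S (S n)) = y (S n).
Proof.
  intros H Hy n E.
  destruct (toda_lim_nonincreasing _ _ _ H Hy (S n)) as [Hlt | ?]; [exfalso | easy].
  destruct (toda_block_start _ _ _ H Hy (S n)) as [k [Hk [Ek [HAk Hblock]]]].
  assert (HAe := toda_A_exp_decay _ _ _ H Hy _ Hlt).
  assert (HAs := toda_A_subexp_decay _ _ _ H Hy _ E).
  set (z := y (S n)) in *.
  assert (Hz : -2 <= z <= 2).
  { split.
    - apply (lim_le (fun _ => -2) (b (S n))); auto using is_lim_const.
      exists 0. intros t Ht. left. now apply (toda_b_bounded _ _ H).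
    - apply (lim_le (b (S n)) (fun _ => 2)); auto using is_lim_const.
      exists 0. intros t Ht. now apply (toda_b_bounded _ _ H). }
  (* Energy of the sites [k] to [i - 1]. Its derivative is the difference of the fluxes at the two
     ends, governed by [A i] and [A k]; for [i = S (S n)] both are exponentially small. *)
  set (Q := fun i t => block_energy b A z i t - block_energy b A z k t).
  assert (Hstep : forall i t, 0 < t -> Q i t <= Q (S i) t).
  { intros i t Ht.
    assert (Hp := toda_A_nonneg _ _ H i t Ht).
    assert (Hsq := pow2_ge_0 (b i t - z)).
    unfold Q. simpl in *. lra. }
  assert (HQ0 : forall i t, 0 < t -> (k <= i)%nat -> 0 <= Q i t).
  { intros i t Ht Hi. induction Hi as [|i Hi IH].
    - unfold Q. lra.
    - specialize (Hstep i t Ht). lra. }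
  assert (Hlim : forall i, (k <= i <= S (S n))%nat -> is_lim (Q i) p_infty 0).
  { intros i [Hi Hi']. induction Hi as [|i Hi IH].
    - apply lim_ext_pos with (f := fun _ => 0) (l := 0); auto using is_lim_const.
      intros t _. unfold Q. ring.
    - specialize (IH ltac:(lia)).
      assert (Hbi : is_lim (fun t => b i t - z) p_infty 0).
      { replace 0 with (y i - z) by (rewrite (Hblock i) by lia; ring).
        apply is_lim_minus'; [apply Hy | apply is_lim_const]. }
      apply lim_ext_pos with (3 := is_lim_plus' _ _ _ _ _ IH
        (is_lim_plus' _ _ _ _ _ (lim_mult _ _ _ _ Hbi Hbi)
          (lim_mult _ _ _ _ (is_lim_const 2 p_infty) (toda_A_lim _ _ H i)))); [|ring].
      intros t _. unfold Q. simpl. ring. }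
  assert (HQe : exp_decay (Q (S (S n)))).
  { eapply exp_decay_of_derive; [| |apply Hlim; lia].
    - intros t Ht. unfold Q.
      apply (is_derive_minus (block_energy b A z (S (S n)))
        (block_energy b A z k)); now apply is_derive_block_energy.
    - assert (HC := exp_decay_scal _ 8 ltac:(lra) (exp_decay_plus _ _ HAe HAk)).
      destruct HC as [c [C [Hc HC]]]. exists c, C. split; [easy|].
      generalize (ultimately_and _ _ (ultimately_gt 0) HC).
      apply ultimately_imp. intros t [Ht Hle].
      apply Rle_trans with (2 := Hle).
      assert (B1 := block_energy_derive_bound _ _ z (S (S n)) t H Ht Hz).
      assert (B2 := block_energy_derive_bound _ _ z k t H Ht Hz).
      apply Rabs_le_between in B1. apply Rabs_le_between in B2.
      unfold minus, plus, opp; simpl in *. lra. }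
  destruct (ultimately_and _ _ (ultimately_gt 0) (exp_decay_lt_subexp _ _ HQe HAs))
    as [T HT].
  destruct (HT (T + 1) ltac:(lra)) as [H0 Hlt'].
  assert (HQ := HQ0 (S n) _ H0 Hk).
  assert (Hp := toda_A_pos _ _ H n _ H0).
  (* The block energy contains [2 * A (S n)], yet it has been shown smaller than [A (S n)] at this
     time. *)
  assert (EQ : Q (S (S n)) (T + 1) = Q (S n) (T + 1) +
    ((b (S n) (T + 1) - z) ^ 2 + 2 * A (S n) (T + 1)))
    by (unfold Q; simpl; ring).
  assert (Hsq := pow2_ge_0 (b (S n) (T + 1) - z)).
  lra.
Qed.

(** If [y n = -2], no later limit is lower, so at the start [k] of the block [A (S k)] is
    subexponential while [A k] is exponentially small. Then [b k] eventually increases to [-2],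
    hence is at most [-2]. *)
Lemma toda_lim_bounds (b A : nat -> R -> R) (y : nat -> R) :
  toda_chain b A -> (forall n, is_lim (b n) p_infty (y n)) ->
  forall n, -2 < y n <= 2.
Proof.
  intros H Hy.
  assert (Hlow : forall n, -2 <= y n).
  { intros n. apply (lim_le (fun _ => -2) (b n)); auto using is_lim_const.
    exists 0. intros t Ht. left. now apply (toda_b_bounded _ _ H). }
  intros n. split.
  2:{ apply (lim_le (b n) (fun _ => 2)); auto using is_lim_const.
      exists 0. intros t Ht. now apply (toda_b_bounded _ _ H). }
  destruct (Hlow n) as [? | E]; [easy | exfalso].
  destruct (toda_block_start _ _ _ H Hy n) as [k [Hk [Ek [HAk _]]]].
  assert (Es : y (S k) = y k).
  { assert (H1 := toda_lim_nonincreasing _ _ _ H Hy k).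
    assert (H2 := Hlow (S k)). lra. }
  assert (HAs := toda_A_subexp_decay _ _ _ H Hy _ Es).
  destruct (ultimately_and _ _ (ultimately_gt 0) (exp_decay_lt_subexp _ _ HAk HAs))
    as [T HT].
  assert (Hle : b k (T + 1) <= y k).
  { apply (nondecreasing_le_lim (b k) T); auto; [|lra].
    apply derive_nonneg_nondecreasing with (df := fun t => A (S k) t - A k t).
    - intros t Ht. apply (toda_db _ _ H). now destruct (HT t Ht).
    - intros t Ht. destruct (HT t Ht). lra. }
  destruct (HT (T + 1) ltac:(lra)) as [H0 _].
  assert (Hb := toda_b_bounded _ _ H k _ H0). lra.
Qed.

(** * From the Schur flow to Volterra and Toda *)

(* [(-1)^(n+1) alpha_n] is stored at index [n + 2] and [alpha_{-1} = -1] at index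
   [1]; the value at index [0] is immaterial. *)
Definition signed_alpha (a : nat -> R -> R) (n : nat) (t : R) : R :=
  match n with
  | O => 0
  | S O => -1
  | S (S k) => (-1) ^ (S k) * a k t
  end.

(** This is [W_n]: with the index shift, [signed_alpha a (S n)] is [g_n]. *)
Definition volterra (a : nat -> R -> R) (n : nat) (t : R) : R :=
  (1 - signed_alpha a n t) * (1 + signed_alpha a (S n) t).

Lemma pow_m1_cases (n : nat) : (-1) ^ n = 1 \/ (-1) ^ n = -1.
Proof.
  induction n as [|n [IH | IH]]; simpl.
  - now left.
  - right. rewrite IH. ring.
  - left. rewrite IH. ring.
Qed.

Lemma signed_alpha_bounds (a : nat -> R -> R) (n : nat) (t : R) :
  schur_flow_solution a -> 0 < t -> -1 <= signed_alpha a n t < 1.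
Proof.
  intros [_ [_ H]] Ht. destruct n as [|[|n]]; simpl; try lra.
  specialize (H n t (Rlt_le _ _ Ht)).
  destruct (pow_m1_cases n) as [-> | ->]; lra.
Qed.

Lemma signed_alpha_gt_m1 (a : nat -> R -> R) (n : nat) (t : R) :
  schur_flow_solution a -> 0 < t -> -1 < signed_alpha a (S (S n)) t.
Proof.
  intros [_ [_ H]] Ht. simpl.
  specialize (H n t (Rlt_le _ _ Ht)).
  destruct (pow_m1_cases n) as [-> | ->]; lra.
Qed.

(** The alternating signs reverse the difference of neighbours. For [n = 0] the constant [-1] is
    consistent because [1 - (-1) ^ 2 = 0]. *)
Lemma is_derive_signed_alpha (a : nat -> R -> R) (n : nat) (t : R) :
  schur_flow_solution a -> 0 < t ->
  is_derive (signed_alpha a (S n)) t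
    ((1 - signed_alpha a (S n) t ^ 2)
      * (signed_alpha a n t - signed_alpha a (S (S n)) t)).
Proof.
  intros [H _] Ht. destruct n as [|n].
  - apply is_derive_eq with 0; [exact (is_derive_const (-1) t) | simpl; ring].
  - apply is_derive_eq with
      ((-1) ^ S n * ((1 - a n t ^ 2) * (a (S n) t - alpha_prev a n t))).
    + apply (is_derive_scal (a n)). now apply H.
    + destruct n as [|n]; simpl; [ring|].
      destruct (pow_m1_cases n) as [-> | ->]; ring.
Qed.

Lemma volterra_0 (a : nat -> R -> R) (t : R) : volterra a 0 t = 0.
Proof. unfold volterra. simpl. ring. Qed.

Lemma volterra_pos (a : nat -> R -> R) (n : nat) (t : R) :
  schur_flow_solution a -> 0 < t -> 0 < volterra a (S n) t.
Proof.
  intros H Ht. unfold volterra.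
  assert (H1 := signed_alpha_bounds a (S n) t H Ht).
  assert (H2 := signed_alpha_gt_m1 a n t H Ht).
  apply Rmult_lt_0_compat; lra.
Qed.

Lemma volterra_nonneg (a : nat -> R -> R) (n : nat) (t : R) :
  schur_flow_solution a -> 0 < t -> 0 <= volterra a n t.
Proof.
  intros H Ht. destruct n as [|n].
  - rewrite volterra_0. lra.
  - left. now apply volterra_pos.
Qed.

Lemma volterra_le (a : nat -> R -> R) (n : nat) (t : R) :
  schur_flow_solution a -> 0 < t -> volterra a n t <= 4.
Proof.
  intros H Ht. unfold volterra.
  assert (H1 := signed_alpha_bounds a n t H Ht).
  assert (H2 := signed_alpha_bounds a (S n) t H Ht). nra.
Qed.

(** With [p], [q], [r] the three consecutive values, [4] minus the sum equals
    [(1 + p) * (1 + q) + (1 - q) * (1 - r)]. This yields the strict lower bound [-2] for the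
    diagonal entries. *)
Lemma volterra_sum_lt (a : nat -> R -> R) (n : nat) (t : R) :
  schur_flow_solution a -> 0 < t -> volterra a n t + volterra a (S n) t < 4.
Proof.
  intros H Ht. unfold volterra.
  assert (H1 := signed_alpha_bounds a n t H Ht).
  assert (H2 := signed_alpha_bounds a (S n) t H Ht).
  assert (H3 := signed_alpha_bounds a (S (S n)) t H Ht).
  set (p := signed_alpha a n t) in *.
  set (q := signed_alpha a (S n) t) in *.
  set (r := signed_alpha a (S (S n)) t) in *.
  assert (0 <= (1 + p) * (1 + q)) by (apply Rmult_le_pos; lra).
  assert (0 < (1 - q) * (1 - r)) by (apply Rmult_lt_0_compat; lra).
  lra.
Qed.

(** At [n = 0] the truncated [pred] is harmless, as the prefactor [volterra a 0 t] vanishes. *)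
Lemma is_derive_volterra (a : nat -> R -> R) (n : nat) (t : R) :
  schur_flow_solution a -> 0 < t ->
  is_derive (volterra a n) t
    (volterra a n t * (volterra a (pred n) t - volterra a (S n) t)).
Proof.
  intros H Ht. destruct n as [|n].
  - apply is_derive_eq with 0; [|rewrite volterra_0; ring].
    apply is_derive_ext with (fun _ => 0); [|exact (is_derive_const 0 t)].
    intros s. now rewrite volterra_0.
  - assert (H1 := is_derive_signed_alpha a n t H Ht).
    assert (H2 := is_derive_signed_alpha a (S n) t H Ht).
    unfold volterra. cbn [pred].
    set (p := signed_alpha a (S n)) in *.
    set (q := signed_alpha a (S (S n))) in *.
    auto_derive.
    + repeat split; eexists; eassumption.
    + replace (Derive (fun x => p x) t) with
        ((1 - p t ^ 2) * (signed_alpha a n t - q t))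
        by (symmetry; now apply is_derive_unique).
      replace (Derive (fun x => q x) t) with
        ((1 - q t ^ 2) * (p t - signed_alpha a (S (S (S n))) t))
        by (symmetry; now apply is_derive_unique).
      ring.
Qed.

Definition toda_b (a : nat -> R -> R) (d k : nat) (t : R) : R :=
  2 - volterra a (2 * k + d) t - volterra a (S (2 * k + d)) t.

(** At [k = 0] and [d <= 1] the first factor is [volterra a 0 t = 0]; for [d = 0] this relies on
    [pred 0 = 0]. *)
Definition toda_A (a : nat -> R -> R) (d k : nat) (t : R) : R :=
  volterra a (pred (2 * k + d)) t * volterra a (2 * k + d) t.

(* [d = 0] and [d = 1] are the two ways of squaring the Volterra lattice. *)
Lemma toda_chain_schur (a : nat -> R -> R) (d : nat) :
  schur_flow_solution a -> (d <= 1)%nat -> toda_chain (toda_b a d) (toda_A a d).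
Proof.
  intros H Hd.
  assert (Hidx : forall k, (2 * S k + d = S (S (2 * k + d)))%nat) by (intros; lia).
  split.
  - intros k t Ht. unfold toda_A. rewrite Hidx. cbn [pred].
    set (m := (2 * k + d)%nat).
    assert (H1 := is_derive_volterra a m t H Ht).
    assert (H2 := is_derive_volterra a (S m) t H Ht). cbn [pred] in H2.
    unfold toda_b. fold m.
    set (p := volterra a m) in *. set (q := volterra a (S m)) in *.
    auto_derive.
    + repeat split; eexists; eassumption.
    + replace (Derive (fun x => p x) t) with
        (p t * (volterra a (pred m) t - q t))
        by (symmetry; now apply is_derive_unique).
      replace (Derive (fun x => q x) t) with
        (q t * (p t - volterra a (S (S m)) t))
        by (symmetry; now apply is_derive_unique).
      ring.
  - intros k t Ht. unfold toda_A, toda_b. rewrite Hidx. cbn [pred].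
    set (m := (2 * k + d)%nat).
    assert (H1 := is_derive_volterra a (S m) t H Ht).
    assert (H2 := is_derive_volterra a (S (S m)) t H Ht). cbn [pred] in H1, H2.
    set (p := volterra a (S m)) in *. set (q := volterra a (S (S m))) in *.
    auto_derive.
    + repeat split; eexists; eassumption.
    + replace (Derive (fun x => p x) t) with (p t * (volterra a m t - q t))
        by (symmetry; now apply is_derive_unique).
      replace (Derive (fun x => q x) t) with
        (q t * (p t - volterra a (S (S (S m))) t))
        by (symmetry; now apply is_derive_unique).
      ring.
  - intros t. unfold toda_A.
    replace (pred (2 * 0 + d)) with O by lia. rewrite volterra_0. ring.
  - intros k t Ht. unfold toda_A. rewrite Hidx. cbn [pred].
    apply Rmult_lt_0_compat; now apply volterra_pos.
  - intros k. exists 16. intros t Ht. unfold toda_A.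
    assert (H1 := volterra_le a (pred (2 * k + d)) t H Ht).
    assert (H2 := volterra_le a (2 * k + d) t H Ht).
    assert (H3 := volterra_nonneg a (pred (2 * k + d)) t H Ht).
    assert (H4 := volterra_nonneg a (2 * k + d) t H Ht). nra.
  - intros k t Ht. unfold toda_b.
    assert (H1 := volterra_sum_lt a (2 * k + d) t H Ht).
    assert (H2 := volterra_nonneg a (2 * k + d) t H Ht).
    assert (H3 := volterra_nonneg a (S (2 * k + d)) t H Ht). lra.
Qed.

(** * From limits of the Toda chains to limits of the coefficients *)

Lemma toda_b_lims (a : nat -> R -> R) (d : nat) :
  schur_flow_solution a -> (d <= 1)%nat ->
  exists y : nat -> R, forall k, is_lim (toda_b a d k) p_infty (y k).
Proof.
  intros H Hd.
  exists (fun k => real (Lim (toda_b a d k) p_infty)). intros k.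
  destruct (toda_b_lim _ _ (toda_chain_schur a d H Hd) k) as [l Hl].
  now rewrite (is_lim_unique _ _ _ Hl).
Qed.

(** Once [signed_alpha a (S (2 * k + d))] tends to [-1], [volterra a (2 * k + d)] tends to [0], so
    the next Volterra variable tends to [2 - y k]; division by its first factor, which tends to [2],
    gives the next coefficient. *)
Lemma signed_alpha_lims (a : nat -> R -> R) (d : nat) (y : nat -> R) :
  schur_flow_solution a -> (d <= 1)%nat ->
  (forall k, is_lim (toda_b a d k) p_infty (y k)) ->
  is_lim (signed_alpha a (S d)) p_infty (-1) ->
  (forall k, -2 < y k < 2) ->
  forall k, is_lim (signed_alpha a (S (2 * k + d))) p_infty (-1) /\
            is_lim (signed_alpha a (S (S (2 * k + d)))) p_infty (- (y k / 2)).
Proof.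
  intros H Hd Hy H0 Hy2.
  assert (HT := toda_chain_schur a d H Hd).
  assert (Hbd : forall n t, 0 < t -> Rabs (1 - signed_alpha a n t) <= 2).
  { intros n t Ht. assert (Hb := signed_alpha_bounds a n t H Ht).
    apply Rabs_le. lra. }
  assert (HW : forall k, is_lim (signed_alpha a (S (2 * k + d))) p_infty (-1) ->
    is_lim (volterra a (S (2 * k + d))) p_infty (2 - y k)).
  { intros k Hk.
    assert (Hm : is_lim (volterra a (2 * k + d)) p_infty 0).
    { apply lim_mult_bounded_0 with (M := 2); [apply Hbd|].
      replace 0 with (1 + -1) by ring.
      apply is_lim_plus'; [apply is_lim_const | easy]. }
    apply lim_ext_pos with (3 := is_lim_minus' _ _ _ _ _
      (is_lim_minus' _ _ _ _ _ (is_lim_const 2 p_infty) Hm) (Hy k)); [|ring].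
    intros t _. unfold toda_b. ring. }
  assert (Hnext : forall k, is_lim (signed_alpha a (S (2 * k + d))) p_infty (-1) ->
    is_lim (signed_alpha a (S (S (2 * k + d)))) p_infty (- (y k / 2))).
  { intros k Hk.
    apply lim_ext_pos with (3 := is_lim_minus' _ _ _ _ _ (lim_div _ _ _ _ (HW k Hk)
      (is_lim_minus' _ _ _ _ _ (is_lim_const 1 p_infty) Hk) ltac:(lra))
      (is_lim_const 1 p_infty)); [|field].
    intros t Ht. unfold volterra. field.
    assert (Hb := signed_alpha_bounds a (S (2 * k + d)) t H Ht). lra. }
  assert (Hmain : forall k, is_lim (signed_alpha a (S (2 * k + d))) p_infty (-1)).
  { induction k as [|k IH]; [exact H0|].
    replace (2 * S k + d)%nat with (S (S (2 * k + d))) by lia.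
    (* The product [A (S k)] of two Volterra variables tends to [0], and its first factor tends to
       [2 - y k > 0], so the second tends to [0]. Its own factor [1 - signed_alpha] tends to
       [1 + y k / 2], positive as [y k > -2]. *)
    assert (HA := toda_A_lim _ _ HT (S k)).
    specialize (Hy2 k).
    unfold toda_A in HA.
    replace (2 * S k + d)%nat with (S (S (2 * k + d))) in HA by lia.
    cbn [pred] in HA.
    assert (HW2 := lim_div _ _ _ _ HA (HW k IH) ltac:(lra)).
    assert (HG := is_lim_minus' _ _ _ _ _ (lim_div _ _ _ _ HW2
      (is_lim_minus' _ _ _ _ _ (is_lim_const 1 p_infty) (Hnext k IH)) ltac:(lra))
      (is_lim_const 1 p_infty)).
    apply lim_ext_pos with (3 := HG).
    - intros t Ht.
      assert (Hp := volterra_pos a (2 * k + d) t H Ht).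
      assert (Hb := signed_alpha_bounds a (S (S (2 * k + d))) t H Ht).
      (* Only the variable to be solved for is unfolded; the one that cancels stays an atom. *)
      unfold volterra at 2. field. split; lra.
    - field. split; lra. }
  intros k. auto.
Qed.

(** The limits descend strictly up to the first repetition and are constant afterwards; without a
    repetition [N] is infinite. *)
Lemma admissible_of_limits (y : nat -> R) :
  (forall n, y (S n) <= y n) ->
  (forall n, y (S n) = y n -> y (S (S n)) = y (S n)) ->
  (forall n, -2 < y n < 2) ->
  exists N x, admissible_seq N x /\
    (forall n, ext_lt n N -> y n / 2 = x (S n)) /\
    (forall n, ext_ge (S n) N -> y n / 2 = last_val N x).
Proof.
  intros Hdec Hst Hb.
  (* The [y] are numbered from [0], the [x] from [1]. *)
  set (x := fun i => y (pred i) / 2).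
  assert (Hmono : forall M : nat, (forall n, (n < M)%nat -> y (S n) < y n) ->
    forall j i, (i < j)%nat -> (j <= M)%nat -> y j < y i).
  { intros M HM. induction j as [|j IH]; intros i Hi Hj; [lia|].
    assert (y (S j) < y j) by (apply HM; lia).
    destruct (Nat.eq_dec i j) as [-> | Hne]; [easy|].
    apply Rlt_trans with (y j); [easy | apply IH; lia]. }
  assert (Hx : forall i, -1 < x i < 1).
  { intros i. unfold x. specialize (Hb (pred i)). lra. }
  destruct (classic (exists n, y (S n) = y n)) as [Hex | Hno].
  - assert (Hmin : exists n, y (S n) = y n /\ forall m, (m < n)%nat -> y (S m) < y m).
    { destruct Hex as [n Hn]. induction n as [n IH] using (well_founded_induction Wf_nat.lt_wf).
      destruct (classic (exists m, (m < n)%nat /\ y (S m) = y m)) as [[m [Hm E]] | Hnm].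
      - now apply (IH m).
      - exists n. split; [easy|]. intros m Hm.
        destruct (Hdec m) as [? | E]; [easy|]. exfalso. eauto. }
    destruct Hmin as [n [Hn Hlt]].
    (* [n] is the least index with [y (S n) = y n], so [y n / 2 = x (S n)] is the last new value. *)
    exists (Some (S n)), x. split; [split; [lia|split]|split].
    + auto.
    + intros i j Hi Hij Hj. simpl in Hj. unfold x.
      assert (y (pred j) < y (pred i)) by (apply (Hmono n); auto; lia). lra.
    + easy.
    + intros m Hm. simpl in Hm |- *. unfold x. cbn [pred].
      assert (Hc : forall i, y (S (n + i)) = y (n + i)%nat /\ y (n + i)%nat = y n).
      { induction i as [|i [E1 E2]].
        - rewrite Nat.add_0_r. auto.
        - rewrite Nat.add_succ_r. split; [auto | congruence]. }
      replace m with (n + (m - n))%nat by lia.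
      now rewrite (proj2 (Hc _)).
  - exists None, x. split; [split; [easy|split]|split].
    + auto.
    + intros i j Hi Hij _. unfold x.
      assert (y (pred j) < y (pred i)); [|lra].
      apply (Hmono (pred j)); [|lia|lia]. intros n _.
      destruct (Hdec n) as [? | E]; [easy|]. exfalso. eauto.
    + easy.
    + intros m [].
Qed.

Lemma signed_alpha_even (a : nat -> R -> R) (k : nat) (t : R) :
  signed_alpha a (S (S (2 * k))) t = - a (2 * k)%nat t.
Proof. cbn [signed_alpha]. rewrite pow_1_odd. ring. Qed.

Lemma signed_alpha_odd (a : nat -> R -> R) (k : nat) (t : R) :
  signed_alpha a (S (S (S (2 * k)))) t = a (2 * k + 1)%nat t.
Proof.
  cbn [signed_alpha]. replace (S (S (2 * k))) with (2 * S k)%nat by lia.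
  rewrite pow_1_even. replace (S (2 * k)) with (2 * k + 1)%nat by lia. ring.
Qed.

Lemma conv_opp (f g : R -> R) (l l' : R) :
  (forall t, f t = - g t) -> l' = - l -> is_lim f p_infty l -> conv g l'.
Proof.
  intros E -> H. unfold conv.
  apply lim_ext_pos with (3 := is_lim_minus' _ _ _ _ _ (is_lim_const 0 p_infty) H); [|ring].
  intros t _. rewrite E. ring.
Qed.

Lemma conv_ext (f g : R -> R) (l l' : R) :
  (forall t, f t = g t) -> l' = l -> is_lim f p_infty l -> conv g l'.
Proof.
  intros E -> H. apply lim_ext_pos with (3 := H); auto.
Qed.

(** * The three asymptotic regimes *)

(** For [d = 0] the recursion starts from the constant value [-1] of [signed_alpha a 1], and
    monotonicity extends [y O < 2] to all limits. *)
Lemma case_iii_of_lt2 (a : nat -> R -> R) (y : nat -> R) :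
  schur_flow_solution a ->
  (forall k, is_lim (toda_b a 0 k) p_infty (y k)) ->
  y O < 2 -> case_iii a.
Proof.
  intros H Hy H2.
  assert (HT := toda_chain_schur a 0 H ltac:(lia)).
  assert (Hdec := toda_lim_nonincreasing _ _ _ HT Hy).
  assert (Hb : forall k, -2 < y k < 2).
  { intros k. split; [apply (toda_lim_bounds _ _ _ HT Hy)|].
    induction k as [|k IH]; [easy|]. specialize (Hdec k). lra. }
  assert (HG := signed_alpha_lims a 0 y H ltac:(lia) Hy (is_lim_const (-1) p_infty) Hb).
  destruct (admissible_of_limits y Hdec (toda_lim_stationary _ _ _ HT Hy) Hb)
    as [N [x [Hadm [Hx1 Hx2]]]].
  assert (Heven : forall n, conv (a (2 * n)%nat) (y n / 2)).
  { intros n. destruct (HG n) as [_ Hn].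
    apply conv_opp with (3 := Hn); [|ring].
    intros t. rewrite Nat.add_0_r. apply signed_alpha_even. }
  exists N, x. split; [easy|]. split; [|split].
  (* Shifted by one, since [HG 0] speaks of the boundary value [-1] at this place. *)
  - intros n. destruct (HG (S n)) as [Hn _].
    apply conv_ext with (3 := Hn); [|easy].
    intros t. rewrite <- signed_alpha_odd. f_equal. lia.
  - intros n Hn. rewrite <- Hx1 by easy. apply Heven.
  - intros n Hn. rewrite <- (Hx2 n) by easy. apply Heven.
Qed.

(** For [d = 1] the recursion starts from [signed_alpha a 2], that is from the convergence of [a 0]
    to [1]. *)
Lemma case_ii_of_lt2 (a : nat -> R -> R) (y : nat -> R) :
  schur_flow_solution a ->
  (forall k, is_lim (toda_b a 1 k) p_infty (y k)) ->
  is_lim (signed_alpha a 2) p_infty (-1) ->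
  y O < 2 -> case_ii a.
Proof.
  intros H Hy H1 H2.
  assert (HT := toda_chain_schur a 1 H ltac:(lia)).
  assert (Hdec := toda_lim_nonincreasing _ _ _ HT Hy).
  assert (Hb : forall k, -2 < y k < 2).
  { intros k. split; [apply (toda_lim_bounds _ _ _ HT Hy)|].
    induction k as [|k IH]; [easy|]. specialize (Hdec k). lra. }
  assert (HG := signed_alpha_lims a 1 y H ltac:(lia) Hy H1 Hb).
  destruct (admissible_of_limits y Hdec (toda_lim_stationary _ _ _ HT Hy) Hb)
    as [N [x [Hadm [Hx1 Hx2]]]].
  assert (Hodd : forall n, conv (a (2 * S n - 1)%nat) (- (y n / 2))).
  { intros n. destruct (HG n) as [_ Hn].
    apply conv_ext with (3 := Hn); [|easy].
    intros t. replace (2 * S n - 1)%nat with (2 * n + 1)%nat by lia.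
    rewrite <- signed_alpha_odd. f_equal. lia. }
  exists N, x. split; [easy|]. split; [|split].
  - intros n. destruct (HG n) as [Hn _].
    apply conv_opp with (3 := Hn); [|ring].
    intros t. rewrite <- signed_alpha_even. f_equal. lia.
  - intros [|n] Hn1 Hn; [lia|]. rewrite <- Hx1; [apply Hodd|].
    destruct N; simpl in *; [lia | easy].
  (* The index [n = 0], where [2 * n - 1] truncates to [0], is ruled out by [1 <= N]. *)
  - intros [|n] Hn.
    + destruct N; simpl in *; [destruct Hadm as [? _]; lia | easy].
    + rewrite <- (Hx2 n) by easy. apply Hodd.
Qed.

(* If [y 1 < 2] then [W_3] stays away from [0], so [W_2' <= - c W_2], and
   [W_1' = - W_1 W_2] makes [W_1 exp (- W_2 / c)] nondecreasing. *)
Lemma toda_second_lim_eq2 (a : nat -> R -> R) (y : nat -> R) :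
  schur_flow_solution a ->
  (forall k, is_lim (toda_b a 0 k) p_infty (y k)) ->
  is_lim (toda_b a 1 0) p_infty 2 -> y 1%nat = 2.
Proof.
  intros H Hy Hz.
  assert (HT := toda_chain_schur a 0 H ltac:(lia)).
  destruct (proj2 (toda_lim_bounds _ _ _ HT Hy 1%nat)) as [Hlt | ?]; [exfalso | easy].
  assert (Hsum : is_lim (fun t => volterra a 1 t + volterra a 2 t) p_infty 0).
  { apply lim_ext_pos with (3 := is_lim_minus' _ _ _ _ _ (is_lim_const 2 p_infty) Hz); [|ring].
    intros t _. unfold toda_b. simpl. ring. }
  assert (Hsq : forall f : R -> R,
    (forall t, 0 < t -> 0 <= f t <= volterra a 1 t + volterra a 2 t) ->
    is_lim f p_infty 0).
  { intros f Hf. apply is_lim_le_le_loc with (3 := Hsum) (f := fun _ => 0);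
      [|apply is_lim_const]. exists 0. exact Hf. }
  assert (HW1 : is_lim (volterra a 1) p_infty 0).
  { apply Hsq. intros t Ht.
    assert (H1 := volterra_nonneg a 1 t H Ht).
    assert (H2 := volterra_nonneg a 2 t H Ht). lra. }
  assert (HW2 : is_lim (volterra a 2) p_infty 0).
  { apply Hsq. intros t Ht.
    assert (H1 := volterra_nonneg a 1 t H Ht).
    assert (H2 := volterra_nonneg a 2 t H Ht). lra. }
  assert (HW3 : is_lim (fun t => volterra a 3 t - volterra a 1 t) p_infty (2 - y 1%nat)).
  { apply lim_ext_pos with (3 := is_lim_minus' _ _ _ _ _ (is_lim_minus' _ _ _ _ _
      (is_lim_minus' _ _ _ _ _ (is_lim_const 2 p_infty) (Hy 1%nat)) HW2) HW1); [|ring].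
    intros t _. unfold toda_b. simpl. ring. }
  (* Half the limit of [W_3 - W_1], which is minus the logarithmic derivative of [W_2]. *)
  set (c := (2 - y 1%nat) / 2).
  assert (Hc : 0 < c) by (unfold c; lra).
  destruct (ultimately_and _ _ (ultimately_gt 0)
    (lim_ultimately_gt _ _ c HW3 ltac:(unfold c; lra))) as [T HTT].
  set (F := fun t => volterra a 1 t * exp (- (volterra a 2 t / c))).
  assert (Hm : forall s t, T < s -> s <= t -> F s <= F t).
  { apply derive_nonneg_nondecreasing with (df := fun t =>
      volterra a 1 t * volterra a 2 t
        * (volterra a 3 t - volterra a 1 t - c) / c
        * exp (- (volterra a 2 t / c))).
    - intros t Ht. destruct (HTT t Ht) as [H0 _].
      assert (D1 := is_derive_volterra a 1 t H H0).
      assert (D2 := is_derive_volterra a 2 t H H0).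
      cbn [pred] in D1, D2. rewrite volterra_0 in D1.
      unfold F. set (p := volterra a 1) in *. set (q := volterra a 2) in *.
      auto_derive.
      + repeat split; eexists; eassumption.
      + replace (Derive (fun x => p x) t) with (p t * (0 - q t))
          by (symmetry; now apply is_derive_unique).
        replace (Derive (fun x => q x) t) with (q t * (p t - volterra a 3 t))
          by (symmetry; now apply is_derive_unique).
        unfold Rdiv. field. lra.
    - intros t Ht. destruct (HTT t Ht) as [H0 H3].
      assert (P1 := volterra_pos a 0 t H H0).
      assert (P2 := volterra_pos a 1 t H H0).
      apply Rmult_le_pos; [|left; apply exp_pos].
      apply Rmult_le_pos; [|left; now apply Rinv_0_lt_compat].
      apply Rmult_le_pos; [|lra]. apply Rmult_le_pos; lra. }
  (* [F] lies between [0] and [W_1], so it tends to [0], which is impossible for a positive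
     nondecreasing function. *)
  assert (HF : is_lim F p_infty 0).
  { apply is_lim_le_le_loc with (f := fun _ => 0) (g := volterra a 1);
      [|apply is_lim_const|exact HW1].
    exists 0. intros t Ht. unfold F.
    assert (P1 := volterra_pos a 0 t H Ht).
    assert (P2 := volterra_pos a 1 t H Ht).
    assert (E := exp_pos (- (volterra a 2 t / c))).
    assert (exp (- (volterra a 2 t / c)) < 1).
    { rewrite <- exp_0. apply exp_increasing.
      assert (0 < volterra a 2 t / c) by now apply Rdiv_lt_0_compat. lra. }
    nra. }
  assert (Hle := nondecreasing_le_lim F T 0 Hm HF (T + 1) ltac:(lra)).
  destruct (HTT (T + 1) ltac:(lra)) as [H0 _].
  assert (HFp : 0 < F (T + 1)).
  { apply Rmult_lt_0_compat; [now apply volterra_pos | apply exp_pos]. }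
  lra.
Qed.

(** Two consecutive limits [2] make all of them [2]. Each [b_k] is [2] minus two nonnegative
    Volterra variables, which therefore vanish in the limit, and [1 + g_n = W_n / (1 - g_{n-1})]
    gives the limit [-1] of [g_n] inductively. *)
Lemma case_i_of_eq2 (a : nat -> R -> R) (y : nat -> R) :
  schur_flow_solution a ->
  (forall k, is_lim (toda_b a 0 k) p_infty (y k)) ->
  y O = 2 -> y 1%nat = 2 -> case_i a.
Proof.
  intros H Hy E0 E1.
  assert (HT := toda_chain_schur a 0 H ltac:(lia)).
  assert (Hall : forall k, y k = 2 /\ y (S k) = 2).
  { induction k as [|k [IH1 IH2]]; [easy|]. split; [easy|].
    rewrite (toda_lim_stationary _ _ _ HT Hy k); congruence. }
  assert (HW : forall n, is_lim (volterra a n) p_infty 0).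
  { intros n.
    assert (Hk : exists k, n = (2 * k)%nat \/ n = S (2 * k)).
    { exists (Nat.div2 n). generalize (Nat.div2_odd n).
      destruct (Nat.odd n); simpl Nat.b2n; lia. }
    destruct Hk as [k Hk].
    assert (Hs : is_lim (fun t => 2 - toda_b a 0 k t) p_infty 0).
    { replace 0 with (2 - y k) by (rewrite (proj1 (Hall k)); ring).
      apply is_lim_minus'; [apply is_lim_const | apply Hy]. }
    apply is_lim_le_le_loc with (3 := Hs) (f := fun _ => 0); [|apply is_lim_const].
    exists 0. intros t Ht. unfold toda_b. rewrite Nat.add_0_r.
    assert (P1 := volterra_nonneg a (2 * k) t H Ht).
    assert (P2 := volterra_nonneg a (S (2 * k)) t H Ht).
    destruct Hk as [-> | ->]; lra. }
  assert (HG : forall n, is_lim (signed_alpha a (S n)) p_infty (-1)).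
  { induction n as [|n IH]; [exact (is_lim_const (-1) p_infty)|].
    apply lim_ext_pos with (3 := is_lim_minus' _ _ _ _ _ (lim_div _ _ _ _ (HW (S n))
      (is_lim_minus' _ _ _ _ _ (is_lim_const 1 p_infty) IH) ltac:(lra))
      (is_lim_const 1 p_infty)); [|field].
    intros t Ht. unfold volterra. field.
    assert (Hb := signed_alpha_bounds a (S n) t H Ht). lra. }
  intros n.
  apply lim_ext_pos with (3 := lim_mult _ _ _ _
    (is_lim_const ((-1) ^ S n) p_infty) (HG (S n))).
  - intros t _. simpl. destruct (pow_m1_cases n) as [-> | ->]; ring.
  - simpl. ring.
Qed.

(** * Mutual exclusion of the three cases *)

Lemma conv_unique (f : R -> R) (l l' : R) : conv f l -> conv f l' -> l = l'.
Proof.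
  intros H1 H2. apply is_lim_unique in H1. apply is_lim_unique in H2.
  rewrite H1 in H2. now injection H2.
Qed.

(** This separates (ii) from (i), where [a 1] tends to [-1]. *)
Lemma case_ii_lim_1 (a : nat -> R -> R) :
  case_ii a -> exists x, x < 1 /\ conv (a 1%nat) (- x).
Proof.
  intros [N [x [[HN [Hx _]] [_ [H1 H2]]]]]. destruct N as [[|[|m]]|].
  - lia.
  (* For [N = 1] the limit comes from the clause for [n >= N], because [1 < N] fails. *)
  - exists (x 1%nat). split; [apply Hx; simpl; lia|].
    apply (H2 1%nat). simpl; lia.
  - exists (x 1%nat). split; [apply Hx; simpl; lia|].
    apply (H1 1%nat); simpl; lia.
  - exists (x 1%nat). split; [apply Hx; simpl; auto|].
    apply (H1 1%nat); simpl; auto.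
Qed.

(** This separates (iii) from (i) and (ii), where [a 0] tends to [1]. *)
Lemma case_iii_lim_0 (a : nat -> R -> R) :
  case_iii a -> exists x, x < 1 /\ conv (a 0%nat) x.
Proof.
  intros [N [x [[HN [Hx _]] [_ [H1 _]]]]]. exists (x 1%nat). split.
  - apply Hx; [lia|]. destruct N; simpl in *; auto.
  - apply (H1 0%nat). destruct N; simpl in *; auto.
Qed.

Theorem theorem1p1 (a : nat -> R -> R) :
  schur_flow_solution a ->
  (case_i a \/ case_ii a \/ case_iii a) /\
  ~ (case_i a /\ case_ii a) /\ ~ (case_i a /\ case_iii a) /\ ~ (case_ii a /\ case_iii a).
Proof.
  intros H. split; [|split; [|split]].
  - destruct (toda_b_lims a 0 H ltac:(lia)) as [y Hy].
    destruct (toda_b_lims a 1 H ltac:(lia)) as [z Hz].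
    destruct (toda_lim_bounds _ _ _ (toda_chain_schur a 0 H ltac:(lia)) Hy 0)
      as [_ [Hlt | E0]].
    { right; right. now apply case_iii_of_lt2 with y. }
    destruct (toda_lim_bounds _ _ _ (toda_chain_schur a 1 H ltac:(lia)) Hz 0)
      as [_ [Hlt | E1]].
    + right; left. apply case_ii_of_lt2 with z; auto.
      (* Since [b_0 = 2 alpha_0], the factor [- (1 / 2)] turns [b_0] into [signed_alpha a 2], which
         is [- alpha_0]. *)
      apply lim_ext_pos with (3 := lim_mult _ _ _ _ (is_lim_const (- (1 / 2)) p_infty)
        (Hy O)); [|rewrite E0; field].
      intros t _. unfold toda_b, volterra. simpl. field.
    + left. apply case_i_of_eq2 with y; auto.
      apply toda_second_lim_eq2 with a; auto. rewrite <- E1. apply Hz.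
  - intros [H1 H2]. destruct (case_ii_lim_1 a H2) as [x [Hx Hc]].
    assert (E := conv_unique _ _ _ (H1 1%nat) Hc). simpl in E. lra.
  - intros [H1 H3]. destruct (case_iii_lim_0 a H3) as [x [Hx Hc]].
    assert (E := conv_unique _ _ _ (H1 0%nat) Hc). simpl in E. lra.
  - intros [H2 H3]. destruct (case_iii_lim_0 a H3) as [x [Hx Hc]].
    destruct H2 as [N [x' [_ [H2 _]]]].
    assert (E := conv_unique _ _ _ (H2 0%nat) Hc). lra.
Qed.
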